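(* Let $a,b:\mathbb{R}\to\mathbb{R}$ be continuous with $a(x)>0$, and let $$u(x)=\int_0^xe^{-\int_0^y\frac{2b(z)}{a(z)}dz}dy,\qquad v(x)=\int_0^x\frac{2}{a(y)}e^{\int_0^y\frac{2b(z)}{a(z)}dz}dy.$$ Let $T>0$. Then, for every $\phi\in\mathcal{C}([0,T];\mathbb{R})$, $E_\phi=\emptyset$, and the functional $$S_{0T}(\phi)=\begin{cases}\dfrac12\displaystyle\int_0^{\sigma_\phi(T)}\Big|\frac{d\,u(\phi(\gamma_\phi(s)))}{ds}\Big|^2ds,&\text{if }u(\phi(\gamma_\phi(s)))\text{ is absolutely continuous and }\phi_0=x,\\+\infty,&\text{for the rest of }\mathcal{C}([0,T];\mathbb{R}),\end{cases}$$ or equivalently the functional equal to $\frac14\int_0^T(u\circ\phi)'(s)(v\circ\phi)'(s)ds$ if $\phi$ is absolutely continuous with $\phi_0=x$ and to $+\infty$ otherwise, coincides, on functions $\phi$ with $\phi_0=x$, with $$\begin{cases}\dfrac12\displaystyle\int_0^T\frac{|\dot\phi_s|^2}{a(\phi_s)}ds,&\text{if }\phi\text{ is absolutely continuous},\\+\infty,&\text{for the rest of }\mathcal{C}([0,T];\mathbb{R}).\end{cases}$$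
   Context: $E_\phi=\{t\in[0,T]:\phi(t)\in E\}$, where $E=(U\cup V)\setminus V_d$, $U$ is the set of points where $u'$ does not exist, $V$ the set of continuity points of $v$ where $v'$ does not exist, and $V_d$ the set of discontinuity points of $v$. $\sigma_\phi(t)=\int_0^t[\frac12\frac{dv}{du}(\phi_s)]^{-1}ds$ with $\frac{dv}{du}=v'/u'$, and $\gamma_\phi(t)=\inf\{s\in[0,T]:\sigma_\phi(s)>t\}$ (with $\inf\emptyset=T$) is its generalized inverse. $x\in\mathbb{R}$ is a fixed initial point. *)

(* Defs.v *)
From HB Require Import structures.
From mathcomp Require Import all_boot all_order all_algebra.
From mathcomp Require Import all_classical all_reals all_analysis.

Set Implicit Arguments.
Unset Strict Implicit.
Unset Printing Implicit Defensive.

Import Order.TTheory GRing.Theory Num.Theory.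
Import numFieldNormedType.Exports.

Local Open Scope classical_set_scope.
Local Open Scope ring_scope.

Section Defs.
Context {R : realType}.
Implicit Types (a b u v f phi : R -> R) (T x y t : R).
Notation mu := (@lebesgue_measure R).

(* Oriented integral: the integral from c to x is minus the integral from x to
   c when x < c. *)
Definition oriented_integral f (c x : R) : R :=
  if c <= x then \int[mu]_(y in `[c, x]) f y
  else - \int[mu]_(y in `[x, c]) f y.

Definition scale_fun a b x : R :=
  oriented_integral
    (fun y => expR (- oriented_integral (fun z => 2 * b z / a z) 0 y)) 0 x.

Definition speed_fun a b x : R :=
  oriented_integral
    (fun y => 2 / a y *
              expR (oriented_integral (fun z => 2 * b z / a z) 0 y)) 0 x.

(* The usual epsilon-delta definition on the interval [c, d], over finite
   families of pairwise disjoint open subintervals. *)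
Definition absolutely_continuous_on (c d : R) f : Prop :=
  forall e : R, 0 < e -> exists2 delta : R, 0 < delta &
    forall (n : nat) (l r : 'I_n -> R),
      (forall i, c <= l i /\ l i <= r i /\ r i <= d) ->
      trivIset [set: 'I_n] (fun i => `]l i, r i[%classic) ->
      \sum_(i < n) (r i - l i) < delta ->
      \sum_(i < n) `|f (r i) - f (l i)| < e.

Definition nondiff_set u : set R := [set y | ~ derivable u y 1].

Definition discont_set v : set R := [set y | ~ {for y, continuous v}].

Definition cont_nondiff_set v : set R :=
  [set y | {for y, continuous v} /\ ~ derivable v y 1].

Definition exceptional_set u v : set R :=
  (nondiff_set u `|` cont_nondiff_set v) `\` discont_set v.

Definition exceptional_times u v T phi : set R :=
  [set t | t \in `[0, T] /\ exceptional_set u v (phi t)].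

Definition dvdu u v y : R := derive1 v y / derive1 u y.

Definition sigma u v phi t : R :=
  \int[mu]_(s in `[0, t]) (2^-1 * dvdu u v (phi s))^-1.

(* The library's inf set0 is 0, whereas here the infimum of the empty set is
   T. *)
Definition gamma u v T phi t : R :=
  let A := [set s | s \in `[0, T] /\ t < sigma u v phi s] in
  if `[< A = set0 >] then T else inf A.

(* In the three functionals below the integrands are nonnegative for the scale
   and speed functions above, so the integrals are taken in [0, +oo]; the
   derivatives at the endpoints of the interval of integration, which depend
   on the values of phi outside [0, T], do not matter. *)

Definition action u v T x phi : \bar R :=
  let S := sigma u v phi T in
  let psi := fun s => u (phi (gamma u v T phi s)) in
  if `[< absolutely_continuous_on 0 S psi /\ phi 0 = x >]
  then ((2^-1)%:E * \int[mu]_(s in `[0%R, S]) (`|derive1 psi s| ^+ 2)%:E)%E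
  else +oo%E.

Definition action_uv u v T x phi : \bar R :=
  if `[< absolutely_continuous_on 0 T phi /\ phi 0 = x >]
  then ((4^-1)%:E *
        \int[mu]_(s in `[0%R, T])
          (derive1 (u \o phi) s * derive1 (v \o phi) s)%:E)%E
  else +oo%E.

Definition action_FW a T phi : \bar R :=
  if `[< absolutely_continuous_on 0 T phi >]
  then ((2^-1)%:E *
        \int[mu]_(s in `[0%R, T]) (`|derive1 phi s| ^+ 2 / a (phi s))%:E)%E
  else +oo%E.

End Defs.

(* Main.v *)
Require Import Defs.
From HB Require Import structures.
From mathcomp Require Import all_boot all_order all_algebra.
From mathcomp Require Import all_classical all_reals all_analysis.
From mathcomp Require Import measurable_realfun ring lra.
Import Order.TTheory GRing.Theory Num.Theory.
Import numFieldNormedType.Exports.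
Set Implicit Arguments.
Unset Strict Implicit.
Unset Printing Implicit Defensive.
Local Open Scope classical_set_scope.
Local Open Scope ring_scope.

(** Write p = u' and q = v'; both are continuous and positive and p q = 2 / a.
In particular u and v are differentiable everywhere, so no time is exceptional.

The clock sigma of a continuous path phi has derivative
w = 2 p(phi) / q(phi), continuous and bounded between two positive constants
on [0, T]. Hence sigma is a C^1 diffeomorphism of [0, T] onto
[0, sigma(T)] whose inverse is gamma, and psi = u o phi o gamma satisfies
psi o sigma = u o phi. Two facts follow.

- Both sigma and u on the compact range of phi are bi-Lipschitz, and sigma is
  increasing, so psi is absolutely continuous exactly when phi is
  ([absolutely_continuous_on_transfer]).
- At an interior time t, psi'(sigma(t)) w(t) = p(phi(t)) phi'(t), whence
  |psi'(sigma(t))|^2 w(t) = p(phi(t)) q(phi(t)) |phi'(t)|^2 / 2, and the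
  substitution s = sigma(t) turns 1/2 int |psi'|^2 into
  1/4 int p(phi) q(phi) |phi'|^2 ([action_energy]).

The last expression, called the energy below, equals
1/4 int (u o phi)' (v o phi)' by the chain rule and 1/2 int |phi'|^2 / a
because p q = 2 / a.

Two choices keep the proof elementary. First, almost everywhere
differentiability of absolutely continuous functions never enters: [derive1]
is 0 wherever the derivative does not exist, and composing with a
diffeomorphism on either side preserves differentiability in both directions,
so the chain rule holds at every point ([derive1_comp_outer],
[derive1_comp_inner]). Secondly, measurability of phi' never enters: the
integral of any nonnegative function is the supremum of the integrals of the
simple functions below it. Monotonicity is immediate from this, and the
substitution formula reduces to simple functions: they give one inequality,
and the other is the same inequality for the inverse diffeomorphism
([ge0_change_of_variables]). *)

(** * Integrals of nonnegative functions without measurability *)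

Section nonmeasurable_integrand.
Local Open Scope ereal_scope.
Context d (T : measurableType d) (R : realType).
Variable mu : {measure set T -> \bar R}.
Import HBNNSimple.

(** The defining supremum of the integral, used to bound the integral of a
function that need not be measurable by testing on simple functions. *)
Lemma ge0_integral_ub (f : T -> \bar R) (x : \bar R) :
  (forall t, 0 <= f t) ->
  (forall h : {nnsfun T >-> R}, (forall t, (h t)%:E <= f t) ->
    \int[mu]_t (h t)%:E <= x) ->
  \int[mu]_t f t <= x.
Proof.
move=> f0 hx; rewrite ge0_integralTE//.
apply: ge_ereal_sup => _ [h /= hf <-].
by rewrite -integralT_nnsfun; exact: hx.
Qed.

Lemma ge0_le_integralT (f g : T -> \bar R) :
  (forall t, 0 <= f t) -> (forall t, f t <= g t) ->
  \int[mu]_t f t <= \int[mu]_t g t.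
Proof.
move=> f0 fg; have g0 t : 0 <= g t by exact: le_trans (fg t).
apply: ge0_integral_ub => // h hf.
rewrite (ge0_integralTE _ g0)//; apply: ereal_sup_ubound.
exists h; last by rewrite integralT_nnsfun.
by move=> t /=; exact: le_trans (fg t).
Qed.

(** The simple functions below f on A, being measurable, can be integrated over
B and over a null set separately. *)
Lemma ge0_integral_setD_null (A B : set T) (f : T -> \bar R) :
  measurable A -> measurable B -> B `<=` A -> mu (A `\` B) = 0 ->
  (forall t, A t -> 0 <= f t) ->
  \int[mu]_(t in A) f t = \int[mu]_(t in B) f t.
Proof.
move=> mA mB BA AB0 f0.
rewrite integral_mkcond [RHS]integral_mkcond; apply/eqP.
rewrite eq_le; apply/andP; split.
- apply: ge0_integral_ub => [|h hf]; first exact: erestrict_ge0.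
  have mh D : measurable_fun D (EFin \o h).
    by apply: measurable_funTS; exact/measurable_EFinP.
  have mCB : measurable (~` B) by exact: measurableC.
  rewrite -[in leLHS](setUv B) ge0_integral_setU//=; last 2 first.
    by move=> t _; rewrite lee_fin.
    by rewrite disj_set2E setICr.
  rewrite [X in _ + X](_ : _ = 0) ?adde0; last first.
    rewrite -[RHS](@null_set_integral _ _ _ mu (A `\` B) (EFin \o h))//.
      rewrite integral_mkcond [RHS]integral_mkcond; apply: eq_integral => t _.
      rewrite !patchE in_setD in_setC.
      case: (boolP (t \in A)) => //= tA; case: ifP => // tB.
      apply/eqP; rewrite eq_le; apply/andP; split; last by rewrite lee_fin.
      by have := hf t; rewrite patchE (negbTE tA).
    exact: measurableD.
  rewrite integral_mkcond; apply: ge0_le_integralT => t.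
    by apply: erestrict_ge0 => ? _; rewrite lee_fin.
  rewrite !patchE; case: ifPn => // /set_mem tB.
  by have := hf t; rewrite patchE mem_set//; exact: BA.
- apply: ge0_le_integralT => t.
    by apply: erestrict_ge0 => s /BA /f0.
  rewrite !patchE; case: ifPn => [/set_mem/BA/mem_set -> //|_].
  by case: ifPn => // /set_mem /f0.
Qed.

(** Dividing by c maps the simple functions below c f to those below f, which
gives one inequality; the other is this one for 1 / c and c f. *)
Lemma ge0_integralZlT (c : R) (f : T -> \bar R) :
  (0 < c)%R -> (forall t, 0 <= f t) ->
  \int[mu]_t (c%:E * f t) = c%:E * \int[mu]_t f t.
Proof.
have le_scale (k : R) (g : T -> \bar R) : (0 < k)%R -> (forall t, 0 <= g t) ->
    \int[mu]_t (k%:E * g t) <= k%:E * \int[mu]_t g t.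
  move=> k0 g0; apply: ge0_integral_ub => [t|h hg].
    by rewrite mule_ge0// lee_fin ltW.
  have -> : \int[mu]_t (h t)%:E = k%:E * \int[mu]_t (k^-1 * h t)%:E.
    rewrite -ge0_integralZl//; last 3 first.
    - by apply/measurable_EFinP; exact: measurable_funM.
    - by move=> t _; rewrite lee_fin mulr_ge0// invr_ge0 ltW.
    - by rewrite lee_fin ltW.
    by apply: eq_integral => t _; rewrite -EFinM mulVKf// gt_eqF.
  rewrite lee_pmul2l//; apply: ge0_le_integralT => t.
    by rewrite lee_fin mulr_ge0// invr_ge0 ltW.
  by rewrite EFinM muleC lee_pdivrMr// muleC hg.
move=> c0 f0; apply/eqP; rewrite eq_le; apply/andP; split.
  exact: le_scale.
have -> : \int[mu]_t f t = \int[mu]_t (c^-1%:E * (c%:E * f t)).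
  by apply: eq_integral => t _; rewrite muleA -EFinM mulVf ?mul1e// gt_eqF.
rewrite muleC -lee_pdivlMr// muleC; apply: le_scale.
  by rewrite invr_gt0.
by move=> t; rewrite mule_ge0// lee_fin ltW.
Qed.

Lemma ge0_integralZl_nonmeasurable (D : set T) (c : R) (f : T -> \bar R) :
  (0 < c)%R -> (forall t, D t -> 0 <= f t) ->
  \int[mu]_(t in D) (c%:E * f t) = c%:E * \int[mu]_(t in D) f t.
Proof.
move=> c0 f0; rewrite integral_mkcond [in RHS]integral_mkcond.
rewrite -ge0_integralZlT//; last exact: erestrict_ge0.
by apply: eq_integral => t _; rewrite !patchE; case: ifP => //; rewrite mule0.
Qed.

End nonmeasurable_integrand.

(** * Image of a measure with density *)

Section density.
Local Open Scope ereal_scope.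
Context d d' (T : measurableType d) (U : measurableType d') (R : realType).
Variables (mu : {measure set T -> \bar R}) (F : T -> U) (f : T -> R).
Hypothesis mF : measurable_fun [set: T] F.
Hypothesis mf : measurable_fun [set: T] f.
Hypothesis f0 : forall t, (0 <= f t)%R.

Definition density_pushforward (A : set U) : \bar R :=
  \int[mu]_(t in F @^-1` A) (f t)%:E.

Let mpre (A : set U) : measurable A -> measurable (F @^-1` A).
Proof. by move=> mA; rewrite -[_ @^-1` _]setTI; exact: mF. Qed.

Let nu0 : density_pushforward set0 = 0.
Proof. by rewrite /density_pushforward preimage_set0 integral_set0. Qed.

Let nu_ge0 A : 0 <= density_pushforward A.
Proof. by apply: integral_ge0 => t _; rewrite lee_fin. Qed.

Let nu_sigma_additive : semi_sigma_additive density_pushforward.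
Proof.
move=> /= A mA tA mUA; rewrite /density_pushforward preimage_bigcup.
rewrite ge0_integral_bigcup//=.
- apply: is_cvg_ereal_nneg_natsum => n _; exact: nu_ge0.
- by move=> k; exact: mpre.
- by apply: measurable_funTS; exact/measurable_EFinP.
- by move=> t _; rewrite lee_fin.
- apply/trivIsetP => i j _ _ ij; rewrite -preimage_setI.
  by move/trivIsetP : tA => /(_ _ _ _ _ ij) ->//; rewrite preimage_set0.
Qed.

HB.instance Definition _ := isMeasure.Build _ _ _ density_pushforward
  nu0 nu_ge0 nu_sigma_additive.

Definition density_measure : {measure set U -> \bar R} := density_pushforward.

Import HBNNSimple.

Lemma integral_density_measure_nnsfun (g : {nnsfun U >-> R}) :
  \int[density_measure]_u (g u)%:E =
  \int[mu]_t (g (F t) * f t)%:E.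
Proof.
transitivity (\int[mu]_t (\sum_(r \in range g)
    (r * \1_(g @^-1` [set r]) (F t) * f t)%:E)); last first.
  apply: eq_integral => t _; rewrite fsumEFin// -mulr_fsuml; congr (_ * _)%:E.
  exact/esym/fimfunE.
have mI r : measurable_fun [set: T]
    (EFin \o (fun t => \1_(g @^-1` [set r]) (F t) * f t)%R).
  apply/measurable_EFinP; apply: measurable_funM => //.
  exact: (measurableT_comp (measurable_indic _)).
have I_ge0 r t : 0 <= (\1_(g @^-1` [set r]) (F t) * f t)%:E.
  by rewrite lee_fin mulr_ge0// indicE.
rewrite integralT_nnsfun sintegralE ge0_integral_fsum//=; last 2 first.
- move=> r; apply/measurable_EFinP; apply: measurable_funM => //.
  apply: measurable_funM => //.
  exact: (measurableT_comp (measurable_indic _)).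
- move=> r t _; rewrite lee_fin mulr_ge0// indicE.
  have [/set_mem <-|] := boolP (F t \in _); last by rewrite mulr0.
  by rewrite mulr1 fun_ge0.
apply: eq_fsbigr => r /set_mem[t _ rE].
under eq_integral do rewrite -mulrA EFinM.
rewrite ge0_integralZl//=; [|exact: mI|by rewrite lee_fin -rE fun_ge0].
congr (_ * _); rewrite /density_pushforward integral_mkcond.
apply: eq_integral => s _; rewrite patchE indicE.
rewrite [F s \in _](_ : _ = (s \in F @^-1` (g @^-1` [set r]))).
  by case: ifP => _; rewrite ?mul1r ?mul0r.
by apply/idP/idP => /set_mem/mem_set.
Qed.

End density.

(** * Derivatives and diffeomorphisms of the line *)

Section calculus.
Context {R : realType}.
Notation mu := (@lebesgue_measure R).
Implicit Types (f F G phi : R -> R).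

Lemma is_derive1_continuous F (l x : R) :
  is_derive x 1 F l -> {for x, continuous F}.
Proof.
by move=> [dF _]; exact/differentiable_continuous/derivable1_diffP.
Qed.

(** [derive1] is a limit, and the limit of a divergent filter is the default
point of R, which is 0. *)
Lemma derive1_nderivable F x : ~ derivable F x 1 -> derive1 F x = 0.
Proof.
move=> ndF; rewrite derive1E.
exact: (dvgP ndF).
Qed.

Section positive_derivative.
Variables F f : R -> R.
Hypothesis dF : forall x : R, is_derive x 1 F (f x).
Hypothesis f_gt0 : forall x, 0 < f x.

Let cF : continuous F.
Proof. by move=> x; exact: is_derive1_continuous (dF x). Qed.

Lemma MVT_continuous x y : x <= y ->
  exists2 z, z \in `[x, y] & F y - F x = f z * (y - x).
Proof.
move=> xy; apply: MVT_segment => //; exact/continuous_subspaceT.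
Qed.

Lemma derive_gt0_lt : {mono F : x y / x < y}.
Proof.
apply: leW_mono; apply: le_mono => x y xy.
have [z _ Fxy] := MVT_continuous (ltW xy).
by rewrite -subr_gt0 Fxy mulr_gt0// subr_gt0.
Qed.

Lemma derive_gt0_inj : injective F.
Proof.
by move=> x y Fxy; have [||//] := ltgtP x y; rewrite -derive_gt0_lt Fxy ltxx.
Qed.

Lemma is_derive_can G x : cancel F G -> is_derive (F x) 1 G (f x)^-1.
Proof.
move=> FK; apply: (@is_derive_inverse _ F G) => //.
- by near=> z; exact: FK.
- by near=> z; exact: cF.
- by rewrite gt_eqF.
Unshelve. all: by end_near. Qed.

(** Since F has a differentiable inverse on its range, F o phi is differentiable
at t exactly when phi is; when it is not, both sides are 0. *)
Lemma derive1_comp_outer phi t :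
  derive1 (F \o phi) t = f (phi t) * derive1 phi t.
Proof.
have [dphi|ndphi] := pselect (derivable phi t 1).
  have dphi' : is_derive t 1 phi (derive1 phi t).
    by rewrite derive1E; exact: DeriveDef.
  have [_ <-] := is_derive1_comp (dF (phi t)) dphi'.
  by rewrite derive1E.
rewrite (derive1_nderivable ndphi) mulr0; apply: derive1_nderivable => dFphi.
(* F need not be onto: outside its range G takes a default value. *)
apply: ndphi; pose G y := get [set x | F x = y].
have FK : cancel F G.
  move=> x; apply: derive_gt0_inj.
  exact: (@getI _ [set z | F z = F x] x).
have dFphi' : is_derive t 1 (F \o phi) ('D_1 (F \o phi) t) by exact: DeriveDef.
have FphiK : G \o (F \o phi) = phi by apply/funext => s /=; exact: FK.
have [+ _] := is_derive1_comp (is_derive_can (phi t) FK) dFphi'.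
by rewrite FphiK.
Qed.

(** As for the outer composition, phi is recovered from phi o F by composing
with the differentiable inverse G of F. *)
Lemma derive1_comp_inner phi t G : cancel F G -> cancel G F ->
  derive1 (phi \o F) t = derive1 phi (F t) * f t.
Proof.
move=> FK GK.
have [dphi|ndphi] := pselect (derivable phi (F t) 1).
  have dphi' : is_derive (F t) 1 phi (derive1 phi (F t)).
    by rewrite derive1E; exact: DeriveDef.
  have [_ <-] := is_derive1_comp dphi' (dF t).
  by rewrite derive1E.
rewrite (derive1_nderivable ndphi) mul0r; apply: derive1_nderivable => dphiF.
apply: ndphi.
have dphiF' : is_derive (G (F t)) 1 (phi \o F) ('D_1 (phi \o F) t).
  by rewrite FK; exact: DeriveDef.
have phiFK : (phi \o F) \o G = phi by apply/funext => s /=; rewrite GK.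
by have [+ _] := is_derive1_comp dphiF' (is_derive_can t FK); rewrite phiFK.
Qed.

End positive_derivative.

Lemma near_eq_derive1 F G t : {near t, F =1 G} -> derive1 F t = derive1 G t.
Proof. by move=> FG; rewrite !derive1E; exact: near_eq_derive. Qed.

(** A slope at least m makes F pass y within distance |y - F(0)| / m of the
origin, so F is onto by the intermediate value theorem. *)
Lemma derive_gt0_bijective F f (m : R) :
  (forall x : R, is_derive x 1 F (f x)) -> 0 < m -> (forall x, m <= f x) ->
  exists2 G, cancel F G & cancel G F.
Proof.
move=> dF m0 mf.
have f0 x : 0 < f x by exact: lt_le_trans (mf x).
have grow x y : x <= y -> m * (y - x) <= F y - F x.
  move=> xy; have [z _ ->] := MVT_continuous dF xy.
  by rewrite ler_wpM2r// subr_ge0.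
have surj y : exists x, F x = y.
  pose r := `|y - F 0| / m.
  have r0 : 0 <= r by rewrite divr_ge0// ltW.
  have mr : m * r = `|y - F 0| by rewrite mulrC divfK// gt_eqF.
  have Fr : y <= F r.
    have := grow _ _ r0; rewrite subr0 mr.
    by have := ler_norm (y - F 0); lra.
  have FNr : F (- r) <= y.
    have Nr0 : - r <= 0 by rewrite oppr_le0.
    have := grow _ _ Nr0; rewrite sub0r opprK mr.
    by have := ler_norm (F 0 - y); rewrite distrC; lra.
  have [|||x _ Fx] := @IVT _ F (- r) r y; last by exists x.
  - by rewrite (le_trans _ r0)// oppr_le0.
  - by apply: continuous_subspaceT => x; exact: is_derive1_continuous (dF x).
  - by rewrite ge_min FNr le_max Fr orbT.
have {}surj y := cid (surj y).
have GK : cancel (fun y => projT1 (surj y)) F.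
  by move=> y; exact: (projT2 (surj y)).
exists (fun y => projT1 (surj y)) => // x.
apply: (derive_gt0_inj dF f0); exact: (GK (F x)).
Qed.

(** By the mean value theorem the minimum and the maximum of F' over the
segment serve as Lipschitz constants. *)
Lemma derive_gt0_bilipschitz F f (a b : R) :
  (forall x : R, is_derive x 1 F (f x)) -> continuous f ->
  (forall x, 0 < f x) -> a <= b ->
  exists k K : R, [/\ 0 < k, 0 < K & forall x y, a <= x <= b -> a <= y <= b ->
    k * `|x - y| <= `|F x - F y| /\ `|F x - F y| <= K * `|x - y|].
Proof.
move=> dF cf f0 ab.
have cfab : {within `[a, b], continuous f} by exact: continuous_subspaceT.
have [c cab fc] := EVT_min ab cfab.
have [C Cab fC] := EVT_max ab cfab.
exists (f c), (f C); split => // x y.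
wlog xy : x y / y <= x.
  by move=> h; case: (leP y x) => [/h//|/ltW/h H] ? ?;
    rewrite distrC [`|F x - F y|]distrC; exact: H.
move=> /andP[ax xb] /andP[ay yb]; have [z + ->] := MVT_continuous dF xy.
rewrite in_itv/= => /andP[yz zx].
have zab : z \in `[a, b] by rewrite in_itv/= (le_trans ay)// (le_trans zx).
rewrite normrM (gtr0_norm (f0 z)).
by split; apply: ler_wpM2r => //; [exact: fc|exact: fC].
Qed.

(** * Change of variables for the Lebesgue integral *)

Section change_of_variable.
Local Open Scope ereal_scope.
Variables (F G f : R -> R).
Hypothesis GK : cancel G F.
Hypothesis dF : forall x : R, is_derive x 1%R F (f x).
Hypothesis cf : continuous f.
Hypothesis f_gt0 : forall x, (0 < f x)%R.

Let cF : continuous F.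
Proof. by move=> x; exact: is_derive1_continuous (dF x). Qed.

Let mF : measurable_fun [set: measurableTypeR R]
  (F : measurableTypeR R -> measurableTypeR R).
Proof. exact: continuous_measurable_fun. Qed.

Let mf : measurable_fun [set: measurableTypeR R] (f : measurableTypeR R -> R).
Proof. exact: continuous_measurable_fun. Qed.

Let f_ge0 x : (0 <= f x)%R.
Proof. exact: ltW. Qed.

(** Lebesgue measure is determined by its values on the intervals ]c, d]; such
an interval has preimage ]G c, G d], over which f = F' integrates to d - c by
the fundamental theorem of calculus. *)
Lemma lebesgue_measure_diffeo (A : set R) : measurable A ->
  mu A = density_measure mu mF mf f_ge0 A.
Proof.
move=> mA; pose nu := density_measure mu mF mf f_ge0.
apply: (@lebesgue_measure_unique R nu _ A mA) => _ [[c d] _ <-] /=.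
rewrite /nu /density_measure /density_pushforward /=.
have lt_F := derive_gt0_lt dF f_gt0.
have ltG x y : (G x < y)%R = (x < F y)%R by rewrite -lt_F GK.
have -> : F @^-1` `]c, d] = `]G c, G d]%classic.
  by apply/seteqP; split => x /=; rewrite !in_itv/= ltG !leNgt ltG.
rewrite lebesgue_measure_itv/= lte_fin.
case: ltP => [cd|dc]; last first.
  rewrite set_itv_ge ?integral_set0// bnd_simp -leNgt.
  by rewrite leNgt ltG GK ltNge dc.
have GcGd : (G c < G d)%R by rewrite ltG GK.
rewrite integral_itv_obnd_cbnd; last exact/measurable_EFinP/measurable_funTS.
rewrite (@continuous_FTC2 _ f F)//.
- by rewrite !GK.
- exact: continuous_subspaceT.
- split=> [x _||].
  + by have [] := dF x.
  + exact/cvg_at_right_filter/cF.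
  + exact/cvg_at_left_filter/cF.
- by move=> x _; rewrite derive1E; have [] := dF x.
Qed.

Import HBNNSimple.

(** For simple g below h the formula is exact, and (g o F) f lies below
(h o F) f. *)
Lemma ge0_le_change_of_variables (h : R -> \bar R) : (forall x, 0 <= h x) ->
  \int[mu]_y h y <= \int[mu]_x (h (F x) * (f x)%:E).
Proof.
move=> h0; apply: ge0_integral_ub => // g gh.
rewrite (eq_measure_integral (density_measure mu mF mf f_ge0)); last first.
  by move=> A mA _; exact: lebesgue_measure_diffeo.
rewrite integral_density_measure_nnsfun; apply: ge0_le_integralT => x.
  by rewrite lee_fin mulr_ge0.
by rewrite EFinM lee_wpmul2r// ?lee_fin// gh.
Qed.

End change_of_variable.

(** The converse inequality is [ge0_le_change_of_variables] for the inverse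
diffeomorphism G and the integrand (h o F) f, since f(G y) G'(y) = 1. *)
Lemma ge0_change_of_variables (F G f : R -> R) (h : R -> \bar R) :
  cancel F G -> cancel G F ->
  (forall x : R, is_derive x 1 F (f x)) -> continuous f ->
  (forall x, 0 < f x) -> (forall x, 0 <= h x)%E ->
  (\int[mu]_y h y = \int[mu]_x (h (F x) * (f x)%:E))%E.
Proof.
move=> FK GK dF cf f_gt0 h0; apply/eqP; rewrite eq_le; apply/andP; split.
  exact: ge0_le_change_of_variables.
have dG (y : R) : is_derive y 1 G (f (G y))^-1.
  by rewrite -[in X in is_derive X](GK y); exact: (is_derive_can dF).
have cG : continuous G by move=> y; exact: is_derive1_continuous (dG y).
have k0 x : (0 <= h (F x) * (f x)%:E)%E by rewrite mule_ge0// lee_fin ltW.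
have cfG : continuous (fun y => (f (G y))^-1).
  move=> y; apply: continuousV; first by rewrite gt_eqF.
  by apply: continuous_comp; [exact: cG|exact: cf].
have fG_gt0 y : 0 < (f (G y))^-1 by rewrite invr_gt0.
apply: (le_trans (ge0_le_change_of_variables FK dG cfG fG_gt0 k0)).
rewrite le_eqVlt; apply/orP; left; apply/eqP; apply: eq_integral => y _.
by rewrite GK -muleA -EFinM divff ?mule1// gt_eqF.
Qed.

(** * Primitives of continuous functions and extension from a segment *)

(** Subtracting a constant, the integral may start at a point A to the left of
both c and x; near x it is then an ordinary integral from A. *)
Lemma is_derive_oriented_integral f (c x : R) : continuous f ->
  is_derive x 1 (oriented_integral f c) (f x).
Proof.
move=> cf; pose A := Num.min c x - 1.
have Ac : A < c by rewrite /A ltrBlDr gt_min ltrDl ltr01.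
have Ax : A < x by rewrite /A ltrBlDr gt_min !ltrDl ltr01 orbT.
have fi y z : mu.-integrable `[y, z] (EFin \o f).
  apply: continuous_compact_integrable; first exact: segment_compact.
  exact: continuous_subspaceT.
pose P y := \int[mu]_(t in `[A, y]) f t.
have intB y z : A <= y -> y <= z -> \int[mu]_(t in `[y, z]) f t = P z - P y.
  move=> Ay yz; rewrite /P.
  rewrite (@Rintegral_itvB _ f (BLeft A) (BRight z) y (fi A z)) ?bnd_simp//.
  rewrite Rintegral_itv_obnd_cbnd//.
  by apply: integrableS (fi y z) => //; exact: subset_itv_oc_cc.
have [dP P'] : derivable P x 1 /\ derive1 P x = f x.
  apply: (@continuous_FTC1_closed _ f A x (x + 1)) => //.
  - by rewrite ltrDl.
  - exact: cf.
have dP' : is_derive x 1 (fun y => P y - P c) (f x).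
  rewrite -[f x]subr0; apply: is_deriveB.
  by rewrite -P' derive1E; exact: DeriveDef.
apply: near_eq_is_derive dP'; near=> y.
have Ay : A <= y.
  suff : y \in `]A, +oo[ by rewrite in_itv/= andbT => /ltW.
  by near: y; apply: near_in_itvoy; rewrite in_itv/= Ax.
rewrite /oriented_integral; case: leP => cy; first by rewrite intB// ltW.
by rewrite intB ?opprB// ltW.
Unshelve. all: by end_near. Qed.

Definition clamp (a b x : R) : R := Num.max a (Num.min b x).

Lemma clamp_itv a b x : a <= b -> a <= clamp a b x <= b.
Proof. by move=> ab; rewrite /clamp le_max lexx ge_max ab ge_min lexx. Qed.

Lemma clamp_id a b x : a <= x <= b -> clamp a b x = x.
Proof. by move=> /andP[ax xb]; rewrite /clamp (min_idPr xb) (max_idPr ax). Qed.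

(** Freezing a path outside [a, b] makes it continuous on the whole line
without changing it on [a, b]. *)
Lemma continuous_clamp a b phi : a <= b ->
  {within `[a, b], continuous phi} -> continuous (phi \o clamp a b).
Proof.
move=> ab /subspace_continuousP cphi x.
have cc : {for x, continuous (clamp a b)}.
  apply: continuous_max; first exact: cvg_cst.
  by apply: continuous_min; [exact: cvg_cst|exact: cvg_id].
have clx : `[a, b]%classic (clamp a b x) by rewrite /= in_itv/= clamp_itv.
apply: cvg_comp (cphi _ clx) => P /= wP.
have {}wP : \forall y \near clamp a b x, `[a, b]%classic y -> P y by [].
have clP : \forall y \near x, `[a, b]%classic (clamp a b y) -> P (clamp a b y).
  exact: cc _ wP.
apply: filterS clP => y; apply.
by rewrite /= in_itv/= clamp_itv.
Qed.

(** * Absolute continuity under change of time and of scale *)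

(** One statement serves both directions between phi and psi: h is sigma or
gamma, and the increments of f are controlled by those of g along h. A
nondecreasing h maps disjoint open intervals to disjoint ones, and the
K-Lipschitz bound controls their total length. *)
Lemma absolutely_continuous_on_transfer (c d c' d' K C : R) (h f g : R -> R) :
  0 < K -> 0 < C ->
  (forall s, c <= s -> s <= d -> c' <= h s /\ h s <= d') ->
  (forall s t, c <= s -> s <= t -> t <= d ->
    [/\ h s <= h t, h t - h s <= K * (t - s)
      & `|f t - f s| <= C * `|g (h t) - g (h s)|]) ->
  absolutely_continuous_on c' d' g -> absolutely_continuous_on c d f.
Proof.
move=> K0 C0 hcd hK ACg e e0.
have [del del0 gdel] := ACg (e / C) (divr_gt0 e0 C0).
exists (del / K); first exact: divr_gt0.
move=> n l r lr tlr sum_lt.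
have hlr i : [/\ h (l i) <= h (r i), h (r i) - h (l i) <= K * (r i - l i)
    & `|f (r i) - f (l i)| <= C * `|g (h (r i)) - g (h (l i))|].
  by have [? [? ?]] := lr i; exact: hK.
apply: (@le_lt_trans _ _ (C * \sum_(i < n) `|g (h (r i)) - g (h (l i))|)).
  by rewrite mulr_sumr; apply: ler_sum => i _; have [] := hlr i.
rewrite mulrC -ltr_pdivlMr//; apply: gdel.
- move=> i; have [cl [lr_i rd]] := lr i; have [hl _ _] := hlr i.
  have [? _] := hcd _ cl (le_trans lr_i rd).
  by have [_ ?] := hcd _ (le_trans cl lr_i) rd.
- apply/trivIsetP => i j _ _ ij; rewrite -subset0 => z [/=].
  rewrite !in_itv/= => /andP[liz zri] /andP[ljz zrj].
  (* If the images of two intervals meet, each left endpoint precedes the other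
     right endpoint, so the midpoint m below lies in both intervals. *)
  have h_lt s t : c <= s <= d -> c <= t <= d -> h s < h t -> s < t.
    move=> /andP[cs sd] /andP[ct td]; rewrite !ltNge; apply: contra => ts.
    by have [] := hK _ _ ct ts sd.
  have bl k : c <= l k <= d.
    by have [? [lrk ?]] := lr k; apply/andP; split => //; exact: le_trans lrk _.
  have br k : c <= r k <= d.
    by have [? [lrk ?]] := lr k; apply/andP; split => //; exact: le_trans lrk.
  have lr' k k' : h (l k) < z -> z < h (r k') -> l k < r k'.
    by move=> lz zr; apply: h_lt => //; exact: lt_trans zr.
  pose m := (Num.max (l i) (l j) + Num.min (r i) (r j)) / 2.
  have /midf_lt[m1 m2] : Num.max (l i) (l j) < Num.min (r i) (r j).
    by rewrite lt_min !gt_max !lr'.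
  move/trivIsetP : tlr => /(_ i j I I ij) /seteqP[+ _] => /(_ m); apply.
  move: m1 m2; rewrite -/m gt_max lt_min => /andP[? ?] /andP[? ?].
  by split; rewrite /= in_itv/=; apply/andP.
- apply: (@le_lt_trans _ _ (K * \sum_(i < n) (r i - l i))).
    by rewrite mulr_sumr; apply: ler_sum => i _; have [] := hlr i.
  by rewrite mulrC -ltr_pdivlMr.
Qed.

End calculus.

(** * The random clock of a path and its inverse *)

Section time_change.
Context {R : realType}.
Notation mu := (@lebesgue_measure R).
Variables (u v p q : R -> R).
Hypotheses (du : forall y : R, is_derive y 1 u (p y))
           (dv : forall y : R, is_derive y 1 v (q y)).
Hypotheses (cp : continuous p) (cq : continuous q).
Hypotheses (p_gt0 : forall y, 0 < p y) (q_gt0 : forall y, 0 < q y).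
Variables (T x : R) (phi : R -> R).
Hypotheses (T_gt0 : 0 < T) (cphi : {within `[0, T], continuous phi}).

(* The path is frozen outside [0, T] so that the clock extends to a
   diffeomorphism of the whole line, to which the substitution formula
   applies. *)
Let w t := (2^-1 * (q (phi (clamp 0 T t)) / p (phi (clamp 0 T t))))^-1.

Let clock := oriented_integral w 0.

Let S := clock T.

Let w_gt0 t : 0 < w t.
Proof. by rewrite invr_gt0 mulr_gt0 ?invr_gt0// divr_gt0. Qed.

Let cw : continuous w.
Proof.
have cphiT := continuous_clamp (ltW T_gt0) cphi.
have cVp : continuous (fun y => (p y)^-1).
  by move=> y; apply: continuousV; [rewrite gt_eqF|exact: cp].
have cqp : continuous (fun y => q y / p y).
  by move=> y; exact: (continuousM (@cq y) (cVp y)).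
have cqp2 : continuous (fun y => 2^-1 * (q y / p y)).
  by move=> y; exact: (continuousM (cvg_cst (2^-1 : R)) (cqp y)).
have cr : continuous (fun y => (2^-1 * (q y / p y))^-1).
  move=> y; have ne0 : 2^-1 * (q y / p y) != 0.
    by rewrite gt_eqF// mulr_gt0 ?invr_gt0// divr_gt0.
  exact: (@continuousV _ _ (fun y => 2^-1 * (q y / p y)) _ ne0 (cqp2 y)).
by move=> t; exact: (continuous_comp (cphiT t) (cr (phi (clamp 0 T t)))).
Qed.

Let dclock (t : R) : is_derive t 1 clock (w t).
Proof. exact: is_derive_oriented_integral. Qed.

Let clock_lt : {mono clock : s t / s < t}.
Proof. exact: derive_gt0_lt dclock w_gt0. Qed.

Let clock_le : {mono clock : s t / s <= t}.
Proof. by move=> s t; rewrite !leNgt clock_lt. Qed.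

Let clock0 : clock 0 = 0.
Proof. by rewrite /clock /oriented_integral lexx set_itv1 Rintegral_set1. Qed.

Let w_clamp t : w (clamp 0 T t) = w t.
Proof. by rewrite /w (clamp_id (clamp_itv t (ltW T_gt0))). Qed.

Let clock_can : exists2 G, cancel clock G & cancel G clock.
Proof.
have [c c0T wc] := EVT_min (ltW T_gt0) (continuous_subspaceT cw).
apply: (derive_gt0_bijective dclock (w_gt0 c)) => t.
by rewrite -(w_clamp t); apply: wc; rewrite in_itv/= clamp_itv// ltW.
Qed.

Let dvduE y : dvdu u v y = q y / p y.
Proof.
by rewrite /dvdu !derive1E; have [_ ->] := du y; have [_ ->] := dv y.
Qed.

Lemma sigma_clock t : 0 <= t <= T -> sigma u v phi t = clock t.
Proof.
move=> /andP[t0 tT]; rewrite /sigma /clock /oriented_integral t0.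
apply: eq_Rintegral => s; rewrite inE/= in_itv/= => /andP[s0 st].
by rewrite dvduE /w clamp_id// s0 (le_trans st).
Qed.

(** The clock is strictly increasing, so the times at which it exceeds clock t
are those after t. *)
Lemma gamma_clock t : 0 <= t <= T -> gamma u v T phi (clock t) = t.
Proof.
move=> /andP[t0 tT]; rewrite /gamma.
have -> : [set s | s \in `[0, T] /\ clock t < sigma u v phi s] =
    `]t, T]%classic.
  apply/seteqP; split => s /=; rewrite !in_itv/=.
    by move=> [s0T]; rewrite sigma_clock// clock_lt => ->; case/andP: s0T.
  move=> /andP[ts sT].
  have s0T : 0 <= s <= T by rewrite sT (le_trans t0 (ltW ts)).
  by rewrite sigma_clock// clock_lt.
(* The set is empty exactly when t = T, where gamma takes its default value. *)
case: asboolP => [tT0|/eqP/set0P[s]].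
  apply/eqP; rewrite eq_le tT andbT leNgt; apply/negP => tT'.
  have : `]t, T]%classic T by rewrite /= in_itv/= tT' lexx.
  by rewrite tT0.
rewrite /= in_itv/= => /andP[ts sT]; apply: inf_itv.
by rewrite bnd_simp (lt_le_trans ts).
Qed.

Let psi s := u (phi (gamma u v T phi s)).

Let psi_clock t : 0 <= t <= T -> psi (clock t) = u (phi t).
Proof. by move=> tT; rewrite /psi gamma_clock. Qed.

Let clock_itv t : (0 <= clock t <= S) = (0 <= t <= T).
Proof. by rewrite -{1}clock0 !clock_le. Qed.

Let clock_surj s : 0 <= s <= S -> exists2 t, 0 <= t <= T & s = clock t.
Proof.
by have [G _ GK] := clock_can; rewrite -{1 2}(GK s) clock_itv; exists (G s).
Qed.

Let ac_psi :
  absolutely_continuous_on 0 S psi <-> absolutely_continuous_on 0 T phi.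
Proof.
have [k [K [k0 K0 clockK]]] :=
  derive_gt0_bilipschitz dclock cw w_gt0 (ltW T_gt0).
have [c cT phi_c] := EVT_min (ltW T_gt0) cphi.
have [C CT phi_C] := EVT_max (ltW T_gt0) cphi.
have [m [M [m0 M0 uM]]] := derive_gt0_bilipschitz du cp p_gt0 (phi_c _ CT).
have phicC t : 0 <= t <= T -> phi c <= phi t <= phi C.
  by move=> t0T; rewrite phi_c ?phi_C.
split.
- apply: (@absolutely_continuous_on_transfer _ 0 T 0 S K m^-1 clock) => //.
  + by rewrite invr_gt0.
  + by move=> s s0 sT; apply/andP; rewrite clock_itv s0.
  move=> s t s0 st tT.
  have s0T : 0 <= s <= T by rewrite s0 (le_trans st).
  have t0T : 0 <= t <= T by rewrite tT (le_trans s0).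
  split; first by rewrite clock_le.
    have [_] := clockK t s t0T s0T.
    by rewrite !ger0_norm ?subr_ge0 ?clock_le.
  rewrite !psi_clock// ler_pdivlMl//.
  by have [] := uM _ _ (phicC _ t0T) (phicC _ s0T).
- pose g := gamma u v T phi.
  apply: (@absolutely_continuous_on_transfer _ 0 S 0 T k^-1 M g) => //.
  + by rewrite invr_gt0.
  + move=> s s0 sS; have [|t t0T ->] := @clock_surj s; first by rewrite s0.
    by rewrite /g gamma_clock//; apply/andP.
  move=> s' t' s0 st tT.
  have [|s s0T sE] := @clock_surj s'; first by rewrite s0 (le_trans st).
  have [|t t0T tE] := @clock_surj t'; first by rewrite tT (le_trans s0).
  move: st; rewrite sE tE clock_le => st.
  rewrite /psi /g !gamma_clock//; split => //.
    have [+ _] := clockK t s t0T s0T.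
    by rewrite !ger0_norm ?subr_ge0 ?clock_le// ler_pdivlMl.
  by have [] := uM _ _ (phicC _ t0T) (phicC _ s0T).
Qed.

(* Only interior times: psi o clock and u o phi agree on [0, T], hence near t
   when 0 < t < T. *)
Let derive1_psi t : 0 < t < T ->
  `|derive1 psi (clock t)| ^+ 2 * w t =
  2^-1 * (p (phi t) * q (phi t) * derive1 phi t ^+ 2).
Proof.
move=> /andP[t0 tT]; have [G clockK GK] := clock_can.
have : derive1 psi (clock t) * w t = p (phi t) * derive1 phi t.
  rewrite -(derive1_comp_inner dclock w_gt0 psi t clockK GK).
  rewrite -(derive1_comp_outer du p_gt0).
  apply: near_eq_derive1; near=> s; apply: psi_clock.
  suff : s \in `]0, T[ by rewrite in_itv/= => /andP[/ltW -> /ltW ->].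
  by near: s; apply: near_in_itvoo; rewrite in_itv/= t0.
have -> : w t = (2^-1 * (q (phi t) / p (phi t)))^-1.
  by rewrite /w clamp_id// !ltW.
rewrite real_normK ?num_real//.
have := p_gt0 (phi t); have := q_gt0 (phi t).
move: (p _) (q _) (derive1 psi _) (derive1 phi t) => P Q d d' Q0 P0.
have Pn0 : P != 0 by rewrite gt_eqF.
have Qn0 : Q != 0 by rewrite gt_eqF.
move=> dE; have -> : d = 2^-1 * Q * d'.
  apply: (mulIf (x := (2^-1 * (Q / P))^-1)).
    by rewrite invr_eq0 !mulf_neq0// ?invr_eq0.
  by rewrite dE; field; rewrite Pn0 Qn0.
by field; rewrite Pn0 Qn0.
Unshelve. all: by end_near. Qed.

(** The common value of the three functionals at absolutely continuous paths
from x, when u' = p and v' = q. *)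
Definition energy : \bar R := (4^-1%:E *
  \int[mu]_(s in `[0%R, T]) (p (phi s) * q (phi s) * derive1 phi s ^+ 2)%:E)%E.

Let psi_integral :
  (\int[mu]_(s in `[0%R, S]) (`|derive1 psi s| ^+ 2)%:E =
   2^-1%:E *
   \int[mu]_(t in `[0%R, T]) (p (phi t) * q (phi t) * derive1 phi t ^+ 2)%:E)%E.
Proof.
have [G clockK GK] := clock_can.
pose k s := (`|derive1 psi s| ^+ 2)%:E.
pose e t := (p (phi t) * q (phi t) * derive1 phi t ^+ 2)%:E.
have k0 s : (0 <= k s)%E by rewrite lee_fin exprn_ge0.
have e0 t : (0 <= e t)%E.
  by rewrite lee_fin mulr_ge0// ?sqr_ge0// mulr_ge0// ltW.
have open (f : R -> \bar R) : (forall t, 0 <= f t)%E ->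
    (\int[mu]_(t in `[0%R, T]) f t = \int[mu]_(t in `]0%R, T[) f t)%E.
  move=> f0; apply: ge0_integral_setD_null => //.
    exact: subset_itv_oo_cc.
  rewrite measureD//= ?setIidr; [|exact: subset_itv_oo_cc|].
    by rewrite !lebesgue_measure_itv/= lte_fin T_gt0 subee.
  by rewrite lebesgue_measure_itv/= lte_fin T_gt0 -EFinD ltry.
rewrite -ge0_integralZl_nonmeasurable//; last by move=> t _; exact: e0.
rewrite [RHS]open; last first.
  by move=> t; apply: mule_ge0; [rewrite lee_fin invr_ge0|exact: e0].
rewrite integral_mkcond (ge0_change_of_variables clockK GK dclock cw w_gt0);
  last exact: erestrict_ge0.
transitivity (\int[mu]_(t in `[0%R, T]) (k (clock t) * (w t)%:E))%E.
  rewrite [RHS]integral_mkcond; apply: eq_integral => t _.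
  rewrite !patchE.
  have -> : (clock t \in `[0, S]%classic) = (t \in `[0, T]%classic).
    by rewrite !mem_setE !in_itv/= clock_itv.
  by case: ifP => //; rewrite mul0e.
rewrite open; last by move=> t; rewrite mule_ge0// lee_fin ltW.
apply: eq_integral => t; rewrite inE/= in_itv/= => tT.
by rewrite /k -EFinM derive1_psi.
Qed.

Lemma action_energy : action u v T x phi =
  if `[< absolutely_continuous_on 0 T phi /\ phi 0 = x >]
  then energy else +oo%E.
Proof.
rewrite /action sigma_clock; last by rewrite lexx ltW.
have -> : `[< absolutely_continuous_on 0 (clock T)
      (fun s => u (phi (gamma u v T phi s))) /\ phi 0 = x >] =
    `[< absolutely_continuous_on 0 T phi /\ phi 0 = x >].
  by apply/asbool_equiv_eq; split=> -[/ac_psi ? ?].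
case: ifP => // _; rewrite psi_integral /energy muleA -EFinM.
by congr (_%:E * _)%E; field.
Qed.

Lemma action_uv_energy : action_uv u v T x phi =
  if `[< absolutely_continuous_on 0 T phi /\ phi 0 = x >]
  then energy else +oo%E.
Proof.
rewrite /action_uv; case: ifP => // _; congr (_ * _)%E.
apply: eq_integral => t _.
rewrite (derive1_comp_outer du p_gt0) (derive1_comp_outer dv q_gt0).
by congr (_%:E); ring.
Qed.

Lemma action_FW_energy a : (forall y, p y * q y = 2 / a y) ->
  action_FW a T phi =
  if `[< absolutely_continuous_on 0 T phi >] then energy else +oo%E.
Proof.
move=> pqE; rewrite /action_FW; case: ifP => // _.
have a_gt0 y : 0 < a y.
  have : 0 < 2 / a y by rewrite -pqE mulr_gt0.
  by rewrite pmulr_rgt0// invr_gt0.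
have -> : (2^-1%:E : \bar R) = (4^-1%:E * 2%:E)%E.
  by rewrite -EFinM; congr (_%:E); field.
rewrite -muleA -ge0_integralZl_nonmeasurable//; last first.
  by move=> t _; rewrite lee_fin divr_ge0// ?exprn_ge0// ltW.
congr (_ * _)%E; apply: eq_integral => t _.
by rewrite -EFinM pqE real_normK ?num_real//; congr (_%:E); ring.
Qed.

End time_change.

(** * The functionals coincide *)

Theorem corollary1p5 (R : realType) (a b : R -> R)
    (a_cont : continuous a) (b_cont : continuous b)
    (a_gt0 : forall y : R, 0 < a y)
    (T : R) (T_gt0 : 0 < T) (x : R) :
  let u := scale_fun a b in
  let v := speed_fun a b in
  forall phi : R -> R, {within `[0, T], continuous phi} ->
    [/\ exceptional_times u v T phi = set0,
        action u v T x phi = action_uv u v T x phi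
      & phi 0 = x -> action u v T x phi = action_FW a T phi].
Proof.
move=> u v phi cphi.
pose B := oriented_integral (fun z => 2 * b z / a z) 0.
pose p y := expR (- B y); pose q y := 2 / a y * expR (B y).
have a_neq0 y : a y != 0 by rewrite gt_eqF.
have cVa : continuous (fun y => (a y)^-1).
  by move=> y; apply: continuousV; last exact: a_cont.
have c2b : continuous (fun y => 2 * b y).
  by move=> y; exact: (continuousM (cvg_cst (2 : R)) (b_cont y)).
have c2Va : continuous (fun y => 2 / a y).
  by move=> y; exact: (continuousM (cvg_cst (2 : R)) (cVa y)).
have c2ba : continuous (fun y => 2 * b y / a y).
  by move=> y; exact: (continuousM (c2b y) (cVa y)).
have cB : continuous B.
  move=> y; apply: is_derive1_continuous.
  exact: (is_derive_oriented_integral 0 y c2ba).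
have cexpB : continuous (fun y => expR (B y)).
  by move=> y; exact: (continuous_comp (cB y) (@continuous_expR R (B y))).
have cNB : continuous (fun y => - B y).
  by move=> y; exact: (continuousN (cB y)).
have cp : continuous p.
  by move=> y; exact: (continuous_comp (cNB y) (@continuous_expR R (- B y))).
have cq : continuous q.
  by move=> y; exact: (continuousM (c2Va y) (cexpB y)).
have du (y : R) : is_derive y 1 u (p y) by exact: is_derive_oriented_integral.
have dv (y : R) : is_derive y 1 v (q y) by exact: is_derive_oriented_integral.
have p_gt0 y : 0 < p y by exact: expR_gt0.
have q_gt0 y : 0 < q y by rewrite mulr_gt0 ?expR_gt0// divr_gt0.
have pq y : p y * q y = 2 / a y.
  by rewrite /p /q mulrCA -expRD addNr expR0 mulr1.
split.
- rewrite -subset0 => t [_ [[ndu|[_ ndv]] _]].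
    by apply: ndu; have [] := du (phi t).
  by apply: ndv; have [] := dv (phi t).
- by rewrite (action_energy du dv)// (action_uv_energy du dv).
- move=> phi0; rewrite (action_energy du dv)//.
  rewrite (action_FW_energy p_gt0 q_gt0 T phi pq).
  congr (if _ then _ else _); apply/asbool_equiv_eq.
  by split=> [[]|].
Qed.
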